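(* Let $n\ge 4$ and let $\mathbf u=\langle u_0,\ldots,u_{k-1}\rangle$ be a sequence of transpositions in $\mathrm{Sym}(n)$ of length $k\ge 3$ whose transpositional multigraph $\mathcal T(\mathbf u)$ is a multitree on vertex set $n$ having exactly $b$ multiedges of even multiplicity. Suppose: (1) no vertex lies on more than one non-simple multiedge; and (2) each multiedge of even multiplicity is a multitwig whose non-leaf vertex has exactly two neighbors. Then $\mathrm{Prod}(\mathbf u)\subseteq 1^b(n-b)^1$, and therefore $\mathbf u$ is conjugacy invariant.
   Context: $n=\{0,\ldots,n-1\}$; permutations compose left to right. For a finite sequence $\mathbf s$ in $\mathrm{Sym}(n)$, $\bigcirc\mathbf s$ is the composite of its terms in order, $\mathrm{Seq}(\mathbf s)$ its set of rearrangements and $\mathrm{Prod}(\mathbf s)=\{\bigcirc\mathbf r:\mathbf r\in\mathrm{Seq}(\mathbf s)\}$; $\mathbf s$ is conjugacy invariant iff every element of $\mathrm{Prod}(\mathbf s)$ is conjugate to $\bigcirc\mathbf s$. $1^b(n-b)^1$ denotes the conjugacy class of permutations of $n$ having exactly $b$ fixed points and one cycle of length $n-b$. $\mathcal T(\mathbf u)$ is the multigraph on vertex set $n$ in which the multiedge $(x\,y)$ has multiplicity equal to the number of terms of $\mathbf u$ equal to $(x\,y)$; non-simple means multiplicity $\ge2$; neighbors are vertices joined by a multiedge of positive multiplicity. A multitree is a multigraph whose underlying simple graph is a tree. A multitwig is a multiedge $(v\,w)$ of positive multiplicity such that $v$ (its leaf) has exactly one neighbor; $w$ is its non-leaf vertex.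 *)

(* Defs.v *)
From mathcomp Require Import all_boot all_fingroup.

Set Implicit Arguments.
Unset Strict Implicit.
Unset Printing Implicit Defensive.

Import GroupScope.

Section Sequences.
Variable n : nat.
Implicit Types (s : seq 'S_n) (g : 'S_n).

(* In MathComp (g * h) x = h (g x), so this product composes left to right. *)
Definition composite s : 'S_n := \prod_(g <- s) g.

Definition Seq s : seq (seq 'S_n) := permutations s.

Definition Prod s : {set 'S_n} := [set:: [seq composite r | r <- Seq s]].

Definition conjugacy_invariant s : Prop :=
  forall g, g \in Prod s -> g \in composite s ^: [set: 'S_n].

Definition transposition g : bool :=
  [exists x, exists y, (x != y) && (g == tperm x y)].

(* The class 1^b (n-b)^1: b fixed points and exactly one cycle of length n-b. *)
Definition class_fix_cycle (b : nat) : {set 'S_n} :=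
  [set g : 'S_n | (#|[set x | g x == x]| == b)
                  && (#|[set C in porbits g | #|C| == (n - b)%N]| == 1%N)].

End Sequences.

Section Multigraphs.
Variable n : nat.

(* G x y is the multiplicity of the multiedge (x y); the multigraphs used here
   are symmetric and vanish on the diagonal. *)
Definition multigraph := 'I_n -> 'I_n -> nat.

Definition transp_multigraph (u : seq 'S_n) : multigraph :=
  fun x y => if x == y then 0%N else count_mem (tperm x y) u.

Variable G : multigraph.

Definition adj : rel 'I_n := fun x y => (0 < G x y)%N.

Definition neighbors (x : 'I_n) : {set 'I_n} := [set y | adj x y].

Definition nonsimple : rel 'I_n := fun x y => (1 < G x y)%N.

Definition even_multiedge : rel 'I_n := fun x y => adj x y && ~~ odd (G x y).

(* Each unordered multiedge is counted once, through its pair with x < y. *)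
Definition num_even_multiedges : nat :=
  #|[set e : 'I_n * 'I_n | (e.1 < e.2)%N && even_multiedge e.1 e.2]|.

(* v is the leaf and w the non-leaf vertex. *)
Definition multitwig (v w : 'I_n) : bool := adj v w && (#|neighbors v| == 1%N).

End Multigraphs.

(* A connected graph without simple cycles of length at least 3. *)
Definition is_tree (T : finType) (e : rel T) : Prop :=
  (forall x y, connect e x y) /\
  (forall p : seq T, (2 < size p)%N -> ~~ ucycleb e p).

Definition is_multitree (n : nat) (G : multigraph n) : Prop := is_tree (adj G).

(* Main.v *)
(* Two occurrences of a transposition t can be erased from a word if the terms
   between them are conjugated by t. When the non-simple terms pairwise commute
   this turns a multitree word with odd multiplicities into a shorter one, and
   eventually into a simple tree, whose product is a full cycle. Prepending one
   copy of each even multiedge makes all multiplicities odd, so the original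
   product has at most b + 1 orbits. On the other hand each even multiedge
   (v w), being touched by a single simple edge, has one of v, w fixed by the
   product; these multiedges are disjoint, so there are at least b fixed points.
   Hence exactly b points are fixed and the others form one orbit. *)
Require Import Defs.
From mathcomp Require Import all_boot all_fingroup zify.

Set Implicit Arguments.
Unset Strict Implicit.
Unset Printing Implicit Defensive.
Import GroupScope.

Lemma split_twice (K : eqType) (u : seq K) t : 1 < count_mem t u ->
  exists a v c, u = a ++ t :: v ++ t :: c.
Proof.
move=> t2; have tu : t \in u.
  by apply: contraLR t2 => /count_memPn ->.
case/splitPr: tu t2 => a c; rewrite count_cat /= eqxx => t2.
have [tc|tc] := boolP (t \in c).
  by case/splitPr: tc => v c'; exists a, v, c'.
have ta : t \in a.
  by apply: contraLR t2 => /count_memPn ->; rewrite (count_memPn tc).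
by case/splitPr: ta => a' v; exists a', v, c; rewrite -catA.
Qed.

(** * Components of an edge list and orbits of the product of its transpositions *)

Section Words.
Variables (T : finType) (N : nat).
Hypothesis card_T : #|T| = N.
Implicit Types (g h t f : {perm T}) (u v : seq {perm T}).
Implicit Types (e : T * T) (w : seq (T * T)).

Definition edge_perm e : {perm T} := tperm e.1 e.2.

Lemma prod_invariant (U : Type) (k : T -> U) u :
  (forall g z, g \in u -> k (g z) = k z) ->
  forall z, k ((\prod_(g <- u) g) z) = k z.
Proof.
elim: u => [|g u IH] kP z; first by rewrite big_nil perm1.
rewrite big_cons permM IH ?kP ?mem_head // => h x hu.
by apply: kP; rewrite inE hu orbT.
Qed.

(* A representative of the connected component of a point in the graph with
   edge list [w], merging components one edge at a time. *)
Fixpoint class_rep w : T -> T :=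
  if w is e :: w' then
    fun z => if class_rep w' z == class_rep w' e.1 then class_rep w' e.2
             else class_rep w' z
  else id.

Definition nclasses w := #|class_rep w @: T|.

Lemma class_rep_edge w e : e \in w -> class_rep w e.1 = class_rep w e.2.
Proof.
elim: w => //= e' w IH; rewrite inE => /predU1P[->|ew].
  by rewrite eqxx; case: ifP.
by rewrite (IH ew).
Qed.

Lemma class_rep_edge_perm w e z :
  e \in w -> class_rep w (edge_perm e z) = class_rep w z.
Proof. by move=> /class_rep_edge ew; rewrite /edge_perm; case: tpermP => // ->. Qed.

Lemma class_rep_connect w x y : class_rep w x = class_rep w y ->
  connect (fun a b => ((a, b) \in w) || ((b, a) \in w)) x y.
Proof.
elim: w x y => [|[p q] w IH] x y /=; first by move=> ->.
set E := (fun a b => _).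
have symE : connect_sym E by apply: sym_connect_sym => a b; rewrite /E orbC.
have sub a b : class_rep w a = class_rep w b -> connect E a b.
  move/IH; apply: connect_sub => {}a {}b ab; apply: connect1.
  by rewrite /E !inE; case/orP: ab => ->; rewrite !orbT.
have pq : connect E p q by apply: connect1; rewrite /E mem_head.
have [xp|_] := eqVneq (class_rep w x); have [yp|_] := eqVneq (class_rep w y).
- by move=> _; apply: sub; rewrite xp.
- by move=> /sub qy; apply: connect_trans (sub _ _ xp) (connect_trans pq qy).
- move=> /sub xq; apply: connect_trans xq _; rewrite symE.
  exact: connect_trans (sub _ _ yp) pq.
- exact: sub.
Qed.

(** An edge inside one class changes no representative. An edge between two classes removes exactly
    the representative of [e.1] from the image. *)
Lemma nclasses_cons e w :
  nclasses (e :: w) + (class_rep w e.1 != class_rep w e.2) = nclasses w.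
Proof.
rewrite /nclasses; have [eq12|neq12] /= := eqVneq.
  rewrite addn0; congr #|pred_of_set _|; apply: eq_imset => z /=.
  by case: eqVneq => // ->.
rewrite addn1 [RHS](cardsD1 (class_rep w e.1)) (imset_f (class_rep w)) // add1n; congr _.+1.
congr #|pred_of_set _|; apply/setP => y; rewrite in_setD1.
apply/imsetP/andP => [[z _ ->]|[yn /imsetP[z _ yE]]].
  case: (eqVneq (class_rep w z)) => [_|zn]; last by rewrite zn imset_f.
  by rewrite eq_sym neq12 imset_f.
by exists z => //; rewrite -yE (negPf yn).
Qed.

Lemma leq_nclasses w : N <= nclasses w + size w.
Proof.
elim: w => [|e w IH] /=; first by rewrite addn0 /nclasses card_imset ?card_T.
by have := nclasses_cons e w; case: (_ != _) => /=; lia.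
Qed.

Lemma porbits_merge e g : e.1 \notin porbit g e.2 ->
  #|porbits (edge_perm e * g)|.+1 = #|porbits g|.
Proof.
move=> ne; have := porbits_mul_tperm g e.1 e.2; rewrite /= ne /=.
have -> : e.1 != e.2 by apply: contraNneq ne => ->; apply: porbit_id.
by rewrite addn1 addn2 => -[].
Qed.

Lemma leq_porbits_edge e g : #|porbits g| <= #|porbits (edge_perm e * g)|.+1.
Proof.
have := porbits_mul_tperm g e.1 e.2; rewrite -/(edge_perm e) /=.
have [_|/porbits_merge <- _] := boolP (e.1 \in _); last exact: leqnn.
by rewrite addn0 => ->; case: (_ != _); rewrite /= ?addn0 ?addn1 // leqW.
Qed.

(** With [leq_nclasses] the hypothesis becomes an equality, so [w] is a forest: every edge joins two
    distinct classes of the edges after it. Prepending it therefore merges two cycles of the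
    product. *)
Lemma porbits_prod_edges w : nclasses w + size w <= N ->
  #|porbits (\prod_(e <- w) edge_perm e)| + size w = N.
Proof.
elim: w => [|e w IH] /=.
  rewrite big_nil => _; rewrite addn0 -card_T -(card_imset T (@set1_inj T)).
  congr #|pred_of_set _|.
  apply: eq_imset => x.
  apply/setP => y; rewrite inE; apply/porbitP/eqP => [[i ->]|->].
    by rewrite expg1n perm1.
  by exists 0; rewrite perm1.
move=> le_n; have := nclasses_cons e w; have := leq_nclasses w.
case: eqVneq => /= [_|neq12]; first by lia.
move=> ge_n Ew; rewrite big_cons; set g := \prod_(e <- w) _ in IH *.
(* [class_rep w] is constant on each cycle of [g] but separates [e.1] from [e.2]. *)
have : e.1 \notin porbit g e.2.
  apply: contra neq12 => /porbitP[i ->]; apply/eqP.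
  elim: i => [|i IHi]; first by rewrite perm1.
  rewrite expgSr permM -{}IHi /g -(big_map edge_perm xpredT id).
  apply: prod_invariant => _ z /mapP[e' e'w ->].
  exact: class_rep_edge_perm.
by move=> /porbits_merge gE; rewrite -addSnnS gE; apply: IH; lia.
Qed.

(** * Connected words of transpositions and the erasing of repeated terms *)

Definition is_tperm g := exists e, g = edge_perm e.

(** Connectedness of the graph drawn by the terms, phrased through invariant labellings so that it
    transfers easily when terms are erased or conjugated. *)
Definition connects u := forall k : T -> T,
  (forall g z, g \in u -> k (g z) = k z) -> forall x y, k x = k y.

Lemma tperms_edges u : (forall g, g \in u -> is_tperm g) ->
  exists w, u = [seq edge_perm e | e <- w].
Proof.
elim: u => [|g u IH] uP; first by exists [::].
have [e ->] := uP g (mem_head _ _).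
have [|w ->] := IH; first by move=> h hu; apply: uP; rewrite inE hu orbT.
by exists (e :: w).
Qed.

Lemma nclasses_connects w : connects [seq edge_perm e | e <- w] -> nclasses w <= 1.
Proof.
move=> cw; rewrite /nclasses.
apply/card_le1_eqP => _ _ /imsetP[x _ ->] /imsetP[y _ ->].
apply: cw => _ z /mapP[e ew ->]; exact: class_rep_edge_perm.
Qed.

Lemma connects_leq_size u :
  (forall g, g \in u -> is_tperm g) -> connects u -> N <= (size u).+1.
Proof.
move=> /tperms_edges[w ->] /nclasses_connects cw.
by have := leq_nclasses w; rewrite size_map; lia.
Qed.

(** Connectedness forces at least [N - 1] terms, so the word is a spanning tree and
    [porbits_prod_edges] applies. *)
Lemma porbits_connects u : (forall g, g \in u -> is_tperm g) ->
  connects u -> size u < N -> #|porbits (\prod_(g <- u) g)| <= 1.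
Proof.
move=> uT cu; have := connects_leq_size uT cu.
have [w uE] := tperms_edges uT; rewrite uE in cu *.
have := nclasses_connects cu; rewrite big_map size_map => le1 leT ltT.
by rewrite -(leq_add2r (size w)) porbits_prod_edges; lia.
Qed.

Lemma tperm_conjg g t : is_tperm g -> is_tperm (g ^ t).
Proof. by case=> e ->; exists (t e.1, t e.2); rewrite /edge_perm tpermJ. Qed.

Lemma tperm_square t : is_tperm t -> t * t = 1.
Proof. by case=> e ->; apply: tperm2. Qed.

(* Three distinct terms [t], [h], [h ^ t] would form a triangle. *)
Lemma no_triangle u t h : (forall g, g \in u -> is_tperm g) ->
  connects u -> size (undup u) < N ->
  t \in u -> h \in u -> h ^ t \in u -> h ^ t = h.
Proof.
move=> uT cu lt_u tu hu htu; apply/eqP; apply/negPn/negP => neq_h.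
(* Dropping [h] keeps the graph connected, because [t] and [h ^ t] together link the two points
   exchanged by [h]. Fewer than [N - 1] edges would then remain. *)
pose v := rem h (undup u).
have memv g : (g \in v) = (g != h) && (g \in u).
  by rewrite mem_rem_uniq ?undup_uniq // inE mem_undup.
have: N <= (size v).+1.
  apply: connects_leq_size => [g|k kP]; first by rewrite memv => /andP[_ /uT].
  apply: cu => g z gu; have [->{g gu}|gh] := eqVneq g h; last first.
    by apply: kP; rewrite memv gh.
  have tP x : k (t x) = k x.
    apply: kP; rewrite memv tu andbT; apply: contraNneq neq_h => ->.
    by rewrite conjgE mulKg.
  have htP x : k ((h ^ t) x) = k x by apply: kP; rewrite memv neq_h.
  by rewrite -tP -permJ htP tP.
have undup_gt0 : 0 < size (undup u).
  by case: (undup u) (mem_undup u h) => //; rewrite hu.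
by rewrite size_rem ?mem_undup // prednK // leqNgt lt_u.
Qed.

Lemma conjg_prod v t : \prod_(g <- v) g ^ t = (\prod_(g <- v) g) ^ t.
Proof.
elim: v => [|g v IH]; first by rewrite !big_nil conj1g.
by rewrite !big_cons IH conjMg.
Qed.

(* Erasing two occurrences of [t] while conjugating by [t] the terms between
   them keeps the product, the connectedness and the parities. *)
Lemma porbits_odd_word u : (forall g, g \in u -> is_tperm g) ->
  connects u -> size (undup u) < N ->
  (forall f g, 1 < count_mem f u -> 1 < count_mem g u -> f ^ g = f) ->
  (forall g, g \in u -> odd (count_mem g u)) ->
  #|porbits (\prod_(g <- u) g)| <= 1.
Proof.
have [m] := ubnP (size u); elim: m u => // m IH u lt_um uT cu lt_u comm_u odd_u.
have [/hasP[t tu t2]|/hasPn simple_u] :=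
  boolP (has (fun t => 1 < count_mem t u) u); last first.
  suff uniq_u : uniq u by apply: porbits_connects; rewrite // -(undup_id uniq_u).
  apply: count_mem_uniq => g; have := simple_u g; rewrite -has_pred1 has_count.
  by case: (count _ u) => [|[|k]] //= /(_ isT).
have [a [v [c uE]]] := split_twice t2.
pose u' := a ++ [seq g ^ t | g <- v] ++ c.
have tt : t * t = 1 := tperm_square (uT t tu).
have tV : t^-1 = t by apply/eqP; rewrite eq_invg_mul tt.
have conjK h : (h ^ t) ^ t = h by rewrite -conjgM tt conjg1.
have conj_eq h g : (h ^ t == g) = (h == g ^ t) by rewrite -{1}(conjK g) (inj_eq (@conjg_inj _ t)).
have countu h : count_mem h u = count_mem h a + count_mem h v + count_mem h c + (t == h).*2.
  by rewrite uE !count_cat /= !count_cat /=; lia.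
have countu' h : count_mem h u' = count_mem h a + count_mem (h ^ t : {perm T}) v + count_mem h c.
  rewrite /u' !count_cat count_map addnA; congr (_ + _ + _).
  by apply: eq_count => g /=; rewrite conj_eq.
have mem_count h (x : seq {perm T}) : (h \in x) = (0 < count_mem h x).
  by rewrite -has_pred1 has_count.
(* Since [t] is repeated, every other repeated term commutes with it. *)
have simple h : h ^ t != h -> count_mem h u <= 1.
  by move=> ht; rewrite leqNgt; apply: contra ht => h2; rewrite comm_u.
have fixed h : h ^ t = h -> count_mem h u = count_mem h u' + (t == h).*2.
  by move=> ht; rewrite countu countu' ht.
(* By [no_triangle], [h] and [h ^ t] do not both occur in [u], so erasing creates no new
   repetition. *)
have moved h : h ^ t != h -> count_mem h u' <= 1.
  move=> hth; have hs := simple h hth.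
  have hts : count_mem (h ^ t : {perm T}) u <= 1 by apply: simple; rewrite conjK eq_sym.
  have [hu0|hu] := posnP (count_mem h u).
    by move: hu0 hts; rewrite countu' !countu; clear; lia.
  have [htu0|htu] := posnP (count_mem (h ^ t : {perm T}) u).
    by move: htu0 hs; rewrite countu' !countu; clear; lia.
  by case/eqP: hth; apply: (no_triangle uT); rewrite // mem_count.
(* An odd number of copies, less two, leaves at least one; this copy keeps [u'] connected. *)
have tu' : t \in u'.
  have ttE : t ^ t = t by rewrite conjgE mulKg.
  by move: (odd_u t tu); rewrite mem_count (fixed t ttE) eqxx; case: (count _ u').
have -> : \prod_(g <- u) g = \prod_(g <- u') g.
  rewrite uE /u' !(big_cat, big_cons) /= big_map conjg_prod conjgE tV.
  by rewrite !mulgA.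
apply: IH.
- by move: lt_um; rewrite uE /u' !size_cat /= size_map size_cat /=; lia.
- move=> g; rewrite /u' !mem_cat => /or3P[ga|/mapP[h hv ->]|gc].
  + by apply: uT; rewrite uE mem_cat ga.
  + by apply/tperm_conjg/uT; rewrite uE !(mem_cat, inE) hv !orbT.
  + by apply: uT; rewrite uE !(mem_cat, inE) gc !orbT.
- move=> k kP; apply: cu => g z; have tP x : k (t x) = k x by apply: kP.
  rewrite uE !(mem_cat, inE) => /or4P[ga|/eqP->//|gv|].
  + by apply: kP; rewrite mem_cat ga.
  + rewrite -tP -permJ kP ?tP // !mem_cat; apply/or3P/Or32.
    by apply/mapP; exists g.
  + by case/predU1P=> [->//|gc]; apply: kP; rewrite !mem_cat gc !orbT.
- apply: leq_ltn_trans lt_u.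
  (* The distinct terms of [u'] are images of distinct terms of [u] under this map. It is
     unambiguous: a term occurring both inside and outside [v] is repeated, hence fixed by
     conjugation by [t]. *)
  rewrite -(size_map (fun f => if f \in v then f ^ t else f) (undup u)).
  apply: uniq_leq_size (undup_uniq _) _ => h; rewrite mem_undup => hu'.
  have [hv|hv] := boolP ((h ^ t : {perm T}) \in v).
    apply/mapP; exists (h ^ t); last by rewrite hv conjK.
    by rewrite mem_undup mem_count countu; rewrite mem_count in hv; lia.
  have hu : h \in u.
    move: hv hu'; rewrite !mem_count countu countu'; lia.
  apply/mapP; exists h; rewrite ?mem_undup //; case: ifP => // {}hv'.
  have [//|hth] := eqVneq (h ^ t) h.
  have := simple h hth; move: hv hv' hu'; rewrite !mem_count countu countu'; lia.
- have big h : 1 < count_mem h u' -> 1 < count_mem h u.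
    by have [/fixed ->|/moved] := eqVneq (h ^ t) h; lia.
  by move=> f g /big f2 /big g2; apply: comm_u.
- move=> h hu'; have [/[dup] hth /fixed hE|/moved] := eqVneq (h ^ t) h.
    have hu : h \in u by rewrite mem_count hE; rewrite mem_count in hu'; lia.
    by have := odd_u h hu; rewrite hE oddD odd_double addbF.
  by rewrite mem_count in hu'; case: (count_mem h u') hu' => [|[]].
Qed.

Lemma porbits_mul_tperms u g : (forall h, h \in u -> is_tperm h) ->
  #|porbits g| <= #|porbits ((\prod_(h <- u) h) * g)| + size u.
Proof.
elim: u => [|h u IH] uT; first by rewrite big_nil mul1g addn0.
rewrite big_cons -mulgA /=; have [e ->] := uT h (mem_head _ _).
have {}IH : #|porbits g| <= #|porbits ((\prod_(h <- u) h) * g)| + size u.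
  by apply: IH => f fu; apply: uT; rewrite inE fu orbT.
by rewrite -addSnnS (leq_trans IH) // leq_add2r leq_porbits_edge.
Qed.

End Words.

(** * The class [1^b (n-b)^1]: recognition by counting orbits, and conjugacy *)

Section ClassFixCycle.
Variables (n b : nat).
Implicit Types (g h : 'S_n).

(** The fixed points give at least [b] singleton orbits, and some point is moved since there are
    fewer than [n] orbits. Its orbit exhausts the bound [b.+1], so it contains all moved points. *)
Lemma class_fix_cycle_count g : b.+1 < n -> b <= #|[set x | g x == x]| ->
  #|porbits g| <= b.+1 -> g \in class_fix_cycle n b.
Proof.
move=> lt_bn; set F := [set x | g x == x] => le_bF le_gb.
have porbit_fix x : x \in F -> porbit g x = [set x].
  rewrite inE => /eqP gx; apply/setP => y; rewrite inE.
  apply/porbitP/eqP => [[i ->]|->]; last by exists 0; rewrite perm1.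
  by rewrite permX; elim: i => //= i ->.
have sub1 : [set [set x] | x in F] \subset porbits g.
  by apply/subsetP => _ /imsetP[x xF ->]; rewrite -porbit_fix ?imset_f.
have card1 : #|[set [set x] | x in F]| = #|F| by apply: card_imset set1_inj.
have [x xF] : exists x, x \notin F.
  apply/existsP; rewrite -negb_forall; apply/negP => /forallP allF.
  have /subset_leq_card : [set [set x] | x in F] \subset porbits g := sub1.
  rewrite card1; have -> : F = setT by apply/setP => z; rewrite allF inE.
  by rewrite cardsT card_ord leqNgt (leq_ltn_trans le_gb).
set C := porbit g x.
have C1 : C \notin [set [set x] | x in F].
  apply/imsetP => -[y yF Cy]; have := porbit_id g x.
  by rewrite -/C Cy inE => /eqP xy; rewrite xy yF in xF.
have subO : C |: [set [set x] | x in F] \subset porbits g.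
  by rewrite subUset sub1 sub1set imset_f.
have := subset_leq_card subO; rewrite cardsU1 C1 card1 add1n => ltF.
have cardF : #|F| = b.
  by apply/eqP; rewrite eqn_leq le_bF andbT -ltnS (leq_trans ltF).
have eqO : C |: [set [set x] | x in F] = porbits g.
  by apply/eqP; rewrite eqEcard subO cardsU1 C1 card1 add1n cardF.
have CF : C = ~: F.
  apply/setP => z; rewrite in_setC; apply/idP/idP => [zC|zF].
    apply: contra C1 => zF; apply/imsetP; exists z => //.
    by rewrite -porbit_fix //; apply/eqP; rewrite eq_sym eq_porbit_mem.
  have: porbit g z \in porbits g by rewrite imset_f.
  rewrite -eqO => /setU1P[<-|/imsetP[y yF zy]]; first exact: porbit_id.
  have := porbit_id g z; rewrite zy inE => /eqP zy'.
  by rewrite zy' yF in zF.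
have cardC : #|C| = (n - b)%N by rewrite CF cardsCs setCK card_ord cardF.
rewrite inE cardF eqxx /= -eqO; apply/cards1P; exists C.
apply/setP => D; rewrite !inE; apply/andP/eqP => [[/predU1P[//|]]|->].
  by move=> /imsetP[y yF ->]; rewrite cards1 => /eqP bn; lia.
by rewrite eqxx cardC eqxx.
Qed.

(** As [n - b] is at least 2, the long cycle contains no fixed point; by cardinality it is then the
    whole set of moved points. *)
Lemma class_fix_cycle_porbit g : b.+1 < n -> g \in class_fix_cycle n b ->
  exists2 x, #|porbit g x| = (n - b)%N &
    forall z, (z \in porbit g x) = (z \notin [set x | g x == x]).
Proof.
move=> lt_bn; rewrite inE => /andP[/eqP cardF /cards1P[C /setP/(_ C)]].
rewrite !inE eqxx => /andP[/imsetP[x _ CE] /eqP cardC].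
rewrite CE in cardC; exists x => // z; rewrite -in_setC.
suff -> : porbit g x = ~: [set x | g x == x] by [].
apply/eqP; rewrite eqEcard cardC cardsCs setCK card_ord cardF leqnn andbT.
apply/subsetP => y xy; rewrite !inE; apply/eqP => gy.
suff: #|porbit g x| <= 1 by rewrite cardC; lia.
rewrite -(cards1 y); apply/subset_leq_card/subsetP => v.
have -> : porbit g x = porbit g y by apply/eqP; rewrite eq_sym eq_porbit_mem.
case/porbitP=> i ->; rewrite inE permX; apply/eqP.
by elim: i => //= i ->.
Qed.

(** List the points of each permutation along its long cycle and then its fixed points. Matching
    equal positions in the two lists gives the conjugating permutation. *)
Lemma class_fix_cycle_conj g h : b.+1 < n ->
  g \in class_fix_cycle n b -> h \in class_fix_cycle n b ->
  h \in g ^: [set: 'S_n].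
Proof.
move=> lt_bn gB hB; set m := (n - b)%N.
pose l k x := traject (k : 'S_n) x m ++ enum [set x | k x == x].
have lP k x : #|porbit k x| = m ->
    (forall z, (z \in porbit k x) = (z \notin [set x | k x == x])) ->
    uniq (l k x) /\ (forall z, z \in l k x).
  move=> cardm memP; have tP z : (z \in traject k x m) = (z \in porbit k x).
    by rewrite porbit_traject cardm.
  split=> [|z]; last by rewrite mem_cat tP mem_enum memP orNb.
  rewrite cat_uniq enum_uniq andbT -{1}cardm uniq_traject_porbit /=.
  by apply/hasPn => z; rewrite mem_enum /= tP memP negbK.
have sizel k x : k \in class_fix_cycle n b -> size (l k x) = n.
  rewrite inE => /andP[/eqP cardF _].
  by rewrite size_cat size_traject -cardE cardF /m; lia.
have nthl k x y i : i < m -> nth y (l k x) i = iter i k x.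
  move=> im; rewrite nth_cat size_traject im.
  by rewrite (set_nth_default x) ?size_traject // nth_traject.
have [x gx gP] := class_fix_cycle_porbit lt_bn gB.
have [y hy hP] := class_fix_cycle_porbit lt_bn hB.
have [ug allg] := lP g x gx gP; have [uh allh] := lP h y hy hP.
pose sg z := nth y (l h y) (index z (l g x)).
have idxlt z : index z (l g x) < n by rewrite -[ltnRHS](sizel g x gB) index_mem.
have sg_inj : injective sg.
  move=> z v /eqP; rewrite /sg nth_uniq ?(sizel h) // => /eqP.
  by move/(congr1 (nth x (l g x))); rewrite !nth_index.
pose s := perm sg_inj.
(* The bound includes [i = m], where both cycles close up; this handles the last point of the
   cycle. *)
have sI i : i <= m -> s (iter i g x) = iter i h y.
  have lt_m i' : i' < m -> s (iter i' g x) = iter i' h y.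
    move=> im; rewrite permE /sg -(nthl g x x) // index_uniq ?nthl //.
    by rewrite (sizel g) // /m in im *; lia.
  rewrite leq_eqVlt => /predU1P[->|/lt_m//].
  by rewrite /m -{1}gx -hy !iter_porbit (lt_m 0) // /m; lia.
apply/imsetP; exists s; rewrite ?inE //; apply/permP => v.
rewrite -[v](permKV s) permJ; move: (s^-1 v) => {v} z.
have := allg z; rewrite mem_cat => /orP[/trajectP[i im ->]|].
  by rewrite -iterS !sI ?(ltnW im).
move=> zF; have := zF; rewrite mem_enum inE => /eqP ->.
suff: s z \in [set x | h x == x] by rewrite inE => /eqP.
rewrite permE /sg index_cat ifN; last first.
  by rewrite /m -gx -porbit_traject gP negbK -mem_enum.
rewrite nth_cat !size_traject ltnNge leq_addr /= addKn -mem_enum.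
apply: mem_nth; move: gB hB; rewrite !inE => /andP[/eqP cg _] /andP[/eqP ch _].
by rewrite -cardE ch -cg cardE index_mem.
Qed.

End ClassFixCycle.

(** A path in [w] between the ends of a new edge would close up to a cycle of [E], so each edge
    merges two classes. A path of a single step is excluded because the transpositions are
    distinct. *)
Lemma acyclic_nclasses (T : finType) (N : nat) (E : rel T) (w : seq (T * T)) :
  #|T| = N -> symmetric E ->
  (forall p : seq T, 2 < size p -> ~~ ucycleb E p) ->
  (forall e, e \in w -> (e.1 != e.2) && E e.1 e.2) ->
  uniq [seq edge_perm e | e <- w] -> nclasses w + size w = N.
Proof.
move=> cardT symE acyc; elim: w => [|[x y] w IH] wE.
  by rewrite addn0 /nclasses card_imset.
rewrite /= => /andP[xyw /IH <-]; last first.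
  by move=> e ew; apply: wE; rewrite inE ew orbT.
rewrite -(nclasses_cons (x, y) w).
suff -> : class_rep w (x, y).1 != class_rep w (x, y).2.
  by rewrite addn1 addSnnS.
apply/eqP => /class_rep_connect /connectP[p0 pP yE].
have /andP[/= neq_xy Exy] := wE (x, y) (mem_head _ _).
move: yE pP; rewrite [(x, y).1]/= [(x, y).2]/= => yE pP.
case/shortenP: pP yE => p pP up _ yE {p0}.
case: p pP up yE => [|z [|z' p]] pP up yE.
- by rewrite yE eqxx in neq_xy.
- move: pP; rewrite /= andbT => xzw; case/negP: xyw; rewrite yE /=.
  apply/mapP; case/orP: xzw => xzw; first by exists (x, z).
  by exists (z, x); rewrite // /edge_perm tpermC.
- have /negP[] := acyc (x :: z :: z' :: p) isT; apply/andP; split=> //.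
  change (path E x (rcons [:: z, z' & p] x)).
  rewrite rcons_path -yE symE Exy andbT.
  apply: sub_path pP => v v' /orP[] vw.
    by have /andP[] := wE (v, v') ltac:(by rewrite inE vw orbT).
  by rewrite symE; have /andP[] := wE (v', v) ltac:(by rewrite inE vw orbT).
Qed.

(* The word moves [v] and [w] only through [tperm v w], except at its single
   term [f], which leaves alone whichever of the two sits at [v]. *)
Lemma prod_fix_twig (T : finType) (u : seq {perm T}) (v w : T) (f : {perm T}) :
  v != w -> ~~ odd (count_mem (tperm v w) u) -> count_mem f u = 1%N -> f v = v ->
  (forall g, g \in u -> g != f -> g != tperm v w -> g v = v /\ g w = w) ->
  exists2 x, x \in [set v; w] & (\prod_(g <- u) g) x = x.
Proof.
move=> neq_vw; set t := tperm v w => even_t f1 fv uP.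
have ft : f != t by apply: contraNneq neq_vw => ft; rewrite -{1}fv ft tpermL.
(* A stretch free of [f] acts on [v] and [w] through the parity of its copies of [t]. *)
have prodP (a : seq {perm T}) : {subset a <= u} -> f \notin a ->
    (\prod_(g <- a) g) v = (if odd (count_mem t a) then w else v) /\
    (\prod_(g <- a) g) w = (if odd (count_mem t a) then v else w).
  elim: a => [|g a IH] au fa /=; first by rewrite big_nil !perm1.
  have [||IHv IHw] := IH.
  - by move=> h ha; apply: au; rewrite inE ha orbT.
  - by apply: contra fa; rewrite inE => ->; rewrite orbT.
  rewrite big_cons !permM oddD; have [->|gt] := eqVneq g t.
    by rewrite tpermL tpermR IHv IHw /=; case: (odd _).
  have gf : g != f by apply: contraNneq fa => ->; rewrite mem_head.
  have [gv gw] := uP g (au g (mem_head _ _)) gf gt.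
  by rewrite gv gw IHv IHw.
have fu : f \in u by rewrite -has_pred1 has_count f1.
case/splitPr: fu f1 even_t uP prodP => a c; rewrite count_cat /= eqxx addnCA.
move=> /eqP; rewrite eqSS addn_eq0 => /andP[/eqP/count_memPn fa /eqP/count_memPn fc].
rewrite count_cat /= (negPf ft) add0n oddD => even_t _ prodP.
have [||av aw] := prodP a => //; first by move=> g ga; rewrite mem_cat ga.
have [||cv cw] := prodP c => //; first by move=> g gc; rewrite mem_cat inE gc !orbT.
(* The stretches before and after [f] have equal parity. If odd, [w] reaches [v], is left there by
   [f] and comes back; if even, [v] never moves overall. *)
move: even_t av aw cv cw => /=.
case: (odd (count_mem t a)); case: (odd (count_mem t c)) => //= _ av aw cv cw.
  by exists w; rewrite ?inE ?eqxx ?orbT // big_cat big_cons !permM /= aw fv cv.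
by exists v; rewrite ?inE ?eqxx // big_cat big_cons !permM /= av fv cv.
Qed.

(** * Words whose transpositional multigraph is a multitree *)

Section MultitreeWords.
Variables (n : nat) (u : seq 'S_n).
Local Notation G := (transp_multigraph u).
Hypothesis transp_u : all (@transposition n) u.
Hypothesis tree_u : is_multitree G.
Hypothesis nonsimple_u : forall x : 'I_n, #|[set y | nonsimple G x y]| <= 1.
Hypothesis even_u : forall x y : 'I_n, even_multiedge G x y ->
     (multitwig G x y /\ #|neighbors G y| = 2)
     \/ (multitwig G y x /\ #|neighbors G x| = 2).
Implicit Types (x y z : 'I_n) (g : 'S_n).

Lemma transp_multigraph_sym x y : G x y = G y x.
Proof. by rewrite /transp_multigraph eq_sym tpermC. Qed.

Lemma mem_tperm_word g : g \in u ->
  exists x y, [/\ x != y, g = tperm x y & count_mem g u = G x y].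
Proof.
move=> /(allP transp_u) /existsP[x /existsP[y /andP[neq_xy /eqP gE]]].
by exists x, y; rewrite /transp_multigraph (negPf neq_xy) gE.
Qed.

Lemma adj_neq x y : adj G x y -> x != y.
Proof. by rewrite /adj /transp_multigraph; case: eqP. Qed.

Lemma adj_mem x y : x != y -> adj G x y = (tperm x y \in u).
Proof.
by move=> xy; rewrite /adj /transp_multigraph (negPf xy) -has_count has_pred1.
Qed.

Lemma adj_sym : symmetric (adj G).
Proof. by move=> x y; rewrite /adj transp_multigraph_sym. Qed.

Lemma nonsimple_uniq x y z : nonsimple G x y -> nonsimple G x z -> y = z.
Proof.
by move=> xy xz; apply: (card_le1_eqP (nonsimple_u x)); rewrite inE.
Qed.

Lemma even_nonsimple x y : even_multiedge G x y -> nonsimple G x y.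
Proof. by rewrite /even_multiedge /nonsimple /adj; case: (G x y) => [|[]]. Qed.

(** Repeated transpositions sharing a vertex coincide by [nonsimple_u], and disjoint ones
    commute. *)
Lemma nonsimple_commute f g :
  1 < count_mem f u -> 1 < count_mem g u -> f ^ g = f.
Proof.
have mem_u h : 1 < count_mem h u -> h \in u.
  by move=> h2; rewrite -has_pred1 has_count ltnW.
move=> f2 g2; have [x [y [neq_xy fE fG]]] := mem_tperm_word (mem_u f f2).
have [z [v [neq_zv gE gG]]] := mem_tperm_word (mem_u g g2).
rewrite fG in f2; rewrite gG in g2.
have moved p q : nonsimple G p q -> tperm p q = f -> g p != p -> f ^ g = f.
  move=> pq pqf gp; suff -> : g = f by rewrite conjgE mulKg.
  move: gp; rewrite -pqf gE; case: tpermP => [pz _|pv _|]; last by rewrite eqxx.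
    by rewrite pz in pq *; rewrite (nonsimple_uniq pq g2).
  rewrite /nonsimple transp_multigraph_sym in g2.
  by rewrite pv in pq *; rewrite (nonsimple_uniq pq g2) tpermC.
have [gx|gx] := eqVneq (g x) x; last exact: (moved x y).
have [gy|gy] := eqVneq (g y) y; last first.
  by apply: (moved y x); rewrite /nonsimple ?(transp_multigraph_sym y) // tpermC.
by rewrite fE tpermJ gx gy.
Qed.

Lemma multitree_connects : connects u.
Proof.
move=> k kP x y; case: tree_u => [/(_ x y) /connectP[p xp ->] _].
elim: p x xp => //= z p IH x /andP[xz /IH <-].
by rewrite -(kP (tperm x z) x) ?tpermL // -adj_mem // adj_neq.
Qed.

Lemma is_tperm_word g : g \in u -> is_tperm g.
Proof. by move=> /mem_tperm_word[x [y [_ -> _]]]; exists (x, y). Qed.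

Lemma multitree_size : 0 < n -> size (undup u) < n.
Proof.
move=> n_gt0; have [|w uE] := @tperms_edges _ (undup u).
  by move=> g; rewrite mem_undup; apply: is_tperm_word.
have wE e : e \in w -> (e.1 != e.2) && adj G e.1 e.2.
  case: e => x y xyw /=.
  have : edge_perm (x, y) \in u by rewrite -mem_undup uE map_f.
  move=> /[dup] xyu /mem_tperm_word[z [v [neq_zv xyE _]]].
  have neq_xy : x != y.
    apply: contraNneq neq_zv => xy; move: xyE; rewrite xy /edge_perm tperm1.
    by move=> /permP/(_ z); rewrite perm1 tpermL => ->.
  by rewrite neq_xy adj_mem.
have uniq_w : uniq [seq edge_perm e | e <- w] by rewrite -uE undup_uniq.
have wn := acyclic_nclasses (card_ord n) adj_sym tree_u.2 wE uniq_w.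
rewrite uE size_map -[ltnRHS]wn -add1n leq_add2r.
by apply/card_gt0P; exists (class_rep w (Ordinal n_gt0)); rewrite imset_f.
Qed.

Let A := [set e : 'I_n * 'I_n | (e.1 < e.2)%N && even_multiedge G e.1 e.2].

Lemma even_edges_disjoint e e' x : e \in A -> e' \in A ->
  x \in [set e.1; e.2] -> x \in [set e'.1; e'.2] -> e = e'.
Proof.
case: e e' => [a c] [a' c']; rewrite !inE /=.
move=> /andP[ac /even_nonsimple acE] /andP[ac' /even_nonsimple acE'].
have acS : nonsimple G c a by rewrite /nonsimple transp_multigraph_sym.
have acS' : nonsimple G c' a' by rewrite /nonsimple transp_multigraph_sym.
move=> /orP[] /eqP-> /orP[] /eqP xE; move: xE ac ac' acE acE' acS acS' => ->.
- by move=> _ _ p q _ _; rewrite (nonsimple_uniq p q).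
(* A vertex that is the smaller end of one edge and the larger end of the other would give
   contradictory orders on the same two points. *)
- by move=> + + p _ _ q; rewrite (nonsimple_uniq p q) => p1 /(ltn_trans p1); rewrite ltnn.
- by move=> + + _ q p _; rewrite (nonsimple_uniq p q) => p1 /(ltn_trans p1); rewrite ltnn.
- by move=> _ _ _ _ p q; rewrite (nonsimple_uniq p q).
Qed.

(** Disjoint edges have disjoint pairs of ends. For [4 <= n] this yields the inequality [b.+1 < n]
    that the class lemmas require. *)
Lemma even_edges_leq : (#|A|).*2 <= n.
Proof.
have e1A (e : 'I_n * 'I_n) : e.1 \in [set e.1; e.2] by rewrite !inE eqxx.
have e2A (e : 'I_n * 'I_n) : e.2 \in [set e.1; e.2] by rewrite !inE eqxx orbT.
have c1 : #|[set e.1 | e in A]| = #|A|.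
  apply: card_in_imset => e e' eA eA' E; apply: (even_edges_disjoint eA eA' (e1A e)).
  by rewrite E.
have c2 : #|[set e.2 | e in A]| = #|A|.
  apply: card_in_imset => e e' eA eA' E; apply: (even_edges_disjoint eA eA' (e2A e)).
  by rewrite E.
rewrite -addnn -{1}c1 -c2 -cardsUI.
suff -> : [set e.1 | e in A] :&: [set e.2 | e in A] = set0.
  by rewrite cards0 addn0 -[leqRHS]card_ord max_card.
apply/eqP; rewrite -subset0; apply/subsetP => x.
case/setIP=> /imsetP[e eA xe] /imsetP[e' eA' xe'].
have ee' : e = e'.
  apply: (even_edges_disjoint (x := x) eA eA'); first by rewrite xe.
  by rewrite xe'.
by move: eA; rewrite inE -xe xe' -ee' ltnn.
Qed.

(** * Fixed points and orbits of the composite of a rearrangement *)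

Variable r : seq 'S_n.
Hypothesis r_u : perm_eq r u.

Let count_r g : count_mem g r = count_mem g u.
Proof. by move/seq.permP: r_u; apply. Qed.

Let mem_r : r =i u. Proof. exact: perm_mem. Qed.

Lemma even_edge_fixed e : e \in A ->
  exists2 x, x \in [set e.1; e.2] & composite r x = x.
Proof.
case: e => a c; rewrite inE /= => /andP[_ eac].
have twig v w : even_multiedge G v w -> multitwig G v w -> #|neighbors G w| = 2 ->
    exists2 x, x \in [set v; w] & composite r x = x.
  move=> evw /andP[vw /cards1P[w' nv]] /eqP/cards2P[z1 [z2 [z12 nw]]].
  have neq_vw := adj_neq vw.
  have wE : w' = w by have := vw; move/setP: nv => /(_ w); rewrite !inE vw => /esym/eqP.
  have [z neq_zv nwE] : exists2 z, z != v & neighbors G w = [set v; z].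
    have : v \in neighbors G w by rewrite inE adj_sym.
    rewrite nw => /set2P[]->; first by exists z2; rewrite // eq_sym.
    by exists z1; rewrite // setUC.
  have wz : adj G w z.
    have : z \in neighbors G w by rewrite nwE !inE eqxx orbT.
    by rewrite inE.
  have neq_wz := adj_neq wz.
  (* The single term is the edge from [w] to its other neighbor [z]; a second copy would put [w] on
     two non-simple multiedges. All further terms avoid [v] and [w], whose neighbors are
     exhausted. *)
  apply: (@prod_fix_twig _ r v w (tperm w z)) => //.
  - by case/andP: evw => _; rewrite count_r /transp_multigraph (negPf neq_vw).
  - have := wz; rewrite count_r /adj /transp_multigraph (negPf neq_wz) => gt0.
    apply/eqP; rewrite eqn_leq gt0 andbT leqNgt; apply/negP => gt1.
    have vwN : nonsimple G w v.
      by rewrite /nonsimple transp_multigraph_sym; apply: even_nonsimple.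
    case/eqP: neq_zv; apply/esym; apply: (nonsimple_uniq vwN).
    by rewrite /nonsimple /transp_multigraph (negPf neq_wz).
  - by rewrite tpermD // eq_sym.
  - move=> g; rewrite mem_r => gu.
    have [x [y [neq_xy gE _]]] := mem_tperm_word gu.
    have nbr p q : p != q -> g = tperm p q -> g != tperm w z -> g != tperm v w ->
        (p != v) && (p != w).
      move=> pq gpq gf gt; have : adj G p q by rewrite adj_mem // -gpq.
      move=> pqA; apply/andP; split; apply/eqP => pE; rewrite pE in gpq pqA.
        move/setP: nv => /(_ q); rewrite !inE pqA wE => /esym/eqP qw.
        by rewrite gpq qw eqxx in gt.
      move/setP: nwE => /(_ q); rewrite !inE pqA => /esym/orP[]/eqP qE.
        by rewrite gpq qE tpermC eqxx in gt.
      by rewrite gpq qE eqxx in gf.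
    move=> gf gt; have /andP[xv xw] := nbr x y neq_xy gE gf gt.
    have /andP[yv yw] : (y != v) && (y != w).
      by apply: (nbr y x) => //; rewrite ?(eq_sym y) // tpermC.
    by rewrite gE !tpermD.
have [[t n2]|[t n2]] := even_u eac; first exact: twig t n2.
have eca : even_multiedge G c a.
  by move: eac; rewrite /even_multiedge adj_sym transp_multigraph_sym.
by have [x xin xE] := twig c a eca t n2; exists x; rewrite // setUC.
Qed.

Lemma even_edges_leq_fixed : #|A| <= #|[set x | composite r x == x]|.
Proof.
(* Selects a fixed end of each even multiedge; disjointness of these edges makes the choice
   injective. *)
pose f e := if composite r e.1 == e.1 then e.1 else e.2 : 'I_n.
have fin e : f e \in [set e.1; e.2].
  by rewrite /f !inE; case: ifP; rewrite eqxx ?orbT.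
rewrite -(@card_in_imset _ _ f); last first.
  move=> e e' eA eA' fE; apply: (even_edges_disjoint eA eA' (fin e)).
  by rewrite fE.
apply/subset_leq_card/subsetP => _ /imsetP[e eA ->]; rewrite inE /f.
have [x xin xE] := even_edge_fixed eA.
case: ifP => // /negbT ne; move: xin; rewrite !inE => /orP[]/eqP xE'.
  by rewrite -xE' xE eqxx in ne.
by rewrite -xE' xE.
Qed.

Lemma porbits_composite : 0 < n -> #|porbits (composite r)| <= #|A|.+1.
Proof.
move=> n_gt0; pose E := [seq edge_perm e | e <- enum A].
have mem_E g : (g \in E) = (g \in u) && ~~ odd (count_mem g u).
  apply/mapP/andP => [[[x y] + ->]|[gu oddg]].
    rewrite mem_enum inE /= => /andP[xy /andP[xyA]].
    have neq_xy := adj_neq xyA.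
    by rewrite /edge_perm /= -adj_mem // /transp_multigraph (negPf neq_xy).
  have [x [y [neq_xy gE gG]]] := mem_tperm_word gu.
  have exy : even_multiedge G x y.
    by rewrite /even_multiedge adj_mem // -gE gu -gG.
  have [xy|yx] := ltnP x y; first by exists (x, y); rewrite // mem_enum inE xy.
  exists (y, x); last by rewrite /edge_perm tpermC.
  rewrite mem_enum inE /= ltn_neqAle yx andbT eq_sym neq_xy.
  by move: exy; rewrite /even_multiedge adj_sym transp_multigraph_sym.
have uniq_E : uniq E.
  rewrite map_inj_in_uniq ?enum_uniq // => -[x y] [x' y'].
  rewrite !mem_enum => e1 e2 eE; apply: (even_edges_disjoint (x := x) e1 e2).
    by rewrite !inE eqxx.
  rewrite !inE /=; apply/negPn/negP; rewrite negb_or => /andP[n1 n2].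
  move/permP: eE => /(_ x); rewrite /edge_perm /= tpermL tpermD 1?eq_sym // => yx.
  by move: e1; rewrite inE /= yx ltnn.
have count_E g : count_mem g (E ++ r) =
    ((g \in u) && ~~ odd (count_mem g u)) + count_mem g u.
  by rewrite count_cat count_uniq_mem // mem_E count_r.
have mem_Er : E ++ r =i u.
  by move=> g; rewrite mem_cat mem_E mem_r; case: (g \in u); rewrite ?orbT.
have le1 : #|porbits (\prod_(g <- E ++ r) g)| <= 1.
  apply: (@porbits_odd_word _ n (card_ord n)).
  - by move=> g; rewrite mem_Er; apply: is_tperm_word.
  - by move=> k kP; apply: multitree_connects => g z gu; apply: kP; rewrite mem_Er.
  - by rewrite (perm_size (perm_undup mem_Er)) multitree_size.
  (* A term receiving an extra copy from [E] has positive even multiplicity in [u], so it was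
     already repeated there. *)
  - have gt1 g : 1 < count_mem g (E ++ r) -> 1 < count_mem g u.
      rewrite count_E; case: (g \in u) => //=.
      by case: (count_mem g u) => [|[]].
    by move=> f g /gt1 f2 /gt1 g2; apply: nonsimple_commute.
  - move=> g; rewrite mem_Er count_E oddD oddb => -> /=.
    by rewrite addNb addbb.
have ET h : h \in E -> is_tperm h by rewrite mem_E => /andP[/is_tperm_word].
apply: leq_trans (porbits_mul_tperms (composite r) ET) _.
by rewrite -big_cat size_map -cardE -add1n leq_add2r.
Qed.

Lemma composite_class : 4 <= n -> composite r \in class_fix_cycle n #|A|.
Proof.
move=> n4; have := even_edges_leq => le_n.
apply: class_fix_cycle_count; first by lia.
  exact: even_edges_leq_fixed.
by apply: porbits_composite; lia.
Qed.

End MultitreeWords.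

Theorem theorem3p6 (n b : nat) (u : seq 'S_n)
  (hn : 4 <= n)
  (hk : 3 <= size u)
  (hu : all (@transposition n) u)
  (htree : is_multitree (transp_multigraph u))
  (hb : num_even_multiedges (transp_multigraph u) = b)
  (h1 : forall x : 'I_n, #|[set y | nonsimple (transp_multigraph u) x y]| <= 1)
  (h2 : forall x y : 'I_n, even_multiedge (transp_multigraph u) x y ->
     (multitwig (transp_multigraph u) x y
        /\ #|neighbors (transp_multigraph u) y| = 2)
     \/ (multitwig (transp_multigraph u) y x
        /\ #|neighbors (transp_multigraph u) x| = 2)) :
  Prod u \subset class_fix_cycle n b /\ conjugacy_invariant u.
Proof.
have prodP g : g \in Prod u -> g \in class_fix_cycle n b.
  rewrite inE => /mapP[r]; rewrite mem_permutations => r_u ->.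
  by rewrite -hb; apply: composite_class.
split=> [|g gP]; first exact/subsetP.
have uP : composite u \in Prod u.
  by rewrite inE; apply/mapP; exists u; rewrite // mem_permutations.
apply: (@class_fix_cycle_conj n b); rewrite ?prodP //.
by have := even_edges_leq h1; rewrite -hb /num_even_multiedges; lia.
Qed.
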